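(* Let $N$ be a positive integer, $\alpha\in[0,1]$, and let $A\subseteq\mathbb{Z}_N^2$ with $|A|=\delta N^2$. For $y\in\mathbb{Z}_N$ put $\delta_y=\frac1N|\{x\in\mathbb{Z}_N:(x,y)\in A\}|$ and let $f(x,y)=\chi_A(x,y)-\delta_y$. Suppose that $$\sum_{y,y'\in\mathbb{Z}_N}\Big|\sum_{x\in\mathbb{Z}_N}f(x,y)\overline{f(x,y')}\Big|^2\le\alpha N^4$$ (i.e. $A$ is $\alpha$-uniform with respect to the basis $(\vec e_1,\vec e_2)$, taking $E_1=E_2=\mathbb{Z}_N$) and that $\sum_{y\in\mathbb{Z}_N}(\delta_y-\delta)^2\le\alpha N$. Then the number of cubes contained in $A$ is at most $(\delta+2\alpha^{1/4})^4N^4$.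
   Context: $\vec e_1=(1,0)$, $\vec e_2=(0,-1)$. A cube is a quadruple $(\vec s,\vec s+u\vec e_2,\vec s+r\vec e_1,\vec s+u\vec e_2+r\vec e_1)$ with $\vec s\in\mathbb{Z}_N^2$, $u,r\in\mathbb{Z}_N$ (degenerate choices $u=0$ or $r=0$ allowed); the number of cubes contained in $A$ is the number of triples $(\vec s,u,r)\in\mathbb{Z}_N^2\times\mathbb{Z}_N\times\mathbb{Z}_N$ for which all four points lie in $A$. *)

(* Defs.v *)
From mathcomp Require Import all_boot all_order all_algebra.
From mathcomp Require Import reals exp.

Set Implicit Arguments.
Unset Strict Implicit.
Unset Printing Implicit Defensive.

Import Order.TTheory GRing.Theory Num.Theory.
Local Open Scope ring_scope.

(* Z_N for a positive integer N = n.+1. The ordinals carry the additive group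
   structure of the integers mod N for every N >= 1, whereas 'Z_N would denote
   Z/2 when N = 1. *)
Notation Zmod n := ('I_(n.+1)) (only parsing).

Section Cubes.

Variable n : nat.

(* inZp 1 is the class of 1 (it equals 0 when N = 1, where 'I_N is not a
   nontrivial ring, so that the ring notation 1 is unavailable). *)
Definition e1 : Zmod n * Zmod n := (inZp 1, 0).
Definition e2 : Zmod n * Zmod n := (0, - inZp 1).

(* The scalar multiple u e, for u in Z_N, is e added to itself u times, u being
   read through its representative in {0, ..., N-1}. *)
Definition cube_in (A : {set Zmod n * Zmod n}) (s : Zmod n * Zmod n)
    (u r : Zmod n) : bool :=
  [&& s \in A, s + e2 *+ u \in A, s + e1 *+ r \in A
    & s + e2 *+ u + e1 *+ r \in A].

Definition num_cubes (A : {set Zmod n * Zmod n}) : nat :=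
  #|[set t : (Zmod n * Zmod n) * Zmod n * Zmod n |
      cube_in A t.1.1 t.1.2 t.2]|.

Variable R : realType.

Definition row_density (A : {set Zmod n * Zmod n}) (y : Zmod n) : R :=
  (n.+1)%:R^-1 * #|[set x : Zmod n | (x, y) \in A]|%:R.

Definition balanced (A : {set Zmod n * Zmod n}) (x y : Zmod n) : R :=
  ((x, y) \in A)%:R - row_density A y.

End Cubes.

(* Main.v *)
(** Writing N = n.+1, cubes in A are quadruples (x, x', y, y') with all four
    points of {x, x'} x {y, y'} in A, so their number is
    sum_{y,y'} (sum_x A(x,y) A(x,y'))^2. Since each row of the balanced
    function f has sum 0, the inner sum is
    g(y,y') + N d(y) d(y'), where g(y,y') = sum_x f(x,y) f(x,y') and d is the
    row density. Uniformity bounds the l^2 norm of g by alpha^(1/2) N^2, and the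
    variance of d bounds that of N d(y) d(y') by (delta^2 + alpha) N^2;
    the triangle inequality in l^2 then gives the result. *)

Require Import Defs.
From mathcomp Require Import all_boot all_order all_algebra.
From mathcomp Require Import reals exp.
From mathcomp Require Import ring lra.

Set Implicit Arguments.
Unset Strict Implicit.
Unset Printing Implicit Defensive.

Import Order.TTheory GRing.Theory Num.Theory.
Local Open Scope ring_scope.

(** By Lagrange's identity, twice the difference of the two sides is a double sum of squares. *)
Lemma sum_CauchySchwarz (R : realFieldType) (I : finType) (a b : I -> R) :
  (\sum_i a i * b i) ^+ 2 <= (\sum_i a i ^+ 2) * (\sum_i b i ^+ 2).
Proof.
suff lagrange : \sum_i \sum_j (a i * b j - a j * b i) ^+ 2 =
    2 * ((\sum_i a i ^+ 2) * (\sum_i b i ^+ 2) - (\sum_i a i * b i) ^+ 2).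
  rewrite -subr_ge0 -(pmulr_rge0 _ (ltr0n R 2)) -lagrange.
  by apply: sumr_ge0 => i _; apply: sumr_ge0 => j _; exact: sqr_ge0.
have mulE (f g : I -> R) : (\sum_i f i) * (\sum_j g j) = \sum_i \sum_j f i * g j.
  by rewrite mulr_suml; apply: eq_bigr => i _; rewrite mulr_sumr.
transitivity ((\sum_i a i ^+ 2) * (\sum_j b j ^+ 2)
  + (\sum_i b i ^+ 2) * (\sum_j a j ^+ 2)
  - 2 * ((\sum_i a i * b i) * (\sum_j a j * b j))); last by ring.
rewrite !mulE mulr_sumr -big_split -sumrB /=; apply: eq_bigr => i _.
rewrite mulr_sumr -big_split -sumrB /=; apply: eq_bigr => j _.
by ring.
Qed.

(** Minkowski's inequality in l^2, squared so that no root appears: Cauchy-Schwarz bounds the cross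
    term by [s * t]. *)
Lemma sum_sqrD_le (R : realFieldType) (I : finType) (a b : I -> R) (s t : R) :
    0 <= s -> 0 <= t ->
    \sum_i a i ^+ 2 <= s ^+ 2 -> \sum_i b i ^+ 2 <= t ^+ 2 ->
  \sum_i (a i + b i) ^+ 2 <= (s + t) ^+ 2.
Proof.
move=> s0 t0 als blt.
have cross : \sum_i a i * b i <= s * t.
  rewrite (le_trans (ler_norm _))// -ler_sqr ?nnegrE ?mulr_ge0//.
  rewrite real_normK ?num_real// (le_trans (sum_CauchySchwarz a b))// exprMn.
  by apply: ler_pM => //; apply: sumr_ge0 => i _; exact: sqr_ge0.
under eq_bigr do rewrite sqrrD.
by rewrite !big_split /=; lra.
Qed.

Section CubeCount.
Variable n : nat.
Implicit Types (A : {set 'I_n.+1 * 'I_n.+1}) (x y u r : 'I_n.+1).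

Lemma Zp1_mulrn r : (inZp 1 : 'I_n.+1) *+ r = r.
Proof. by rewrite Zp_mulrn; apply/val_inj; rewrite /= modnMml mul1n modn_small. Qed.

Lemma e1_mulrn r : e1 n *+ r = (r, 0).
Proof.
by rewrite [LHS]surjective_pairing !raddfMn /= Zp1_mulrn mul0rn.
Qed.

Lemma e2_mulrn u : e2 n *+ u = (0, - u).
Proof.
by rewrite [LHS]surjective_pairing !raddfMn /= mulNrn Zp1_mulrn mul0rn.
Qed.

Lemma cube_inE A x y u r :
  cube_in A (x, y) u r =
  [&& (x, y) \in A, (x, y - u) \in A, (x + r, y) \in A & (x + r, y - u) \in A].
Proof.
rewrite /cube_in e1_mulrn e2_mulrn.
have addE (a b c d : 'I_n.+1) : (a, b) + (c, d) = (a + c, b + d) by [].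
by rewrite !addE !addr0.
Qed.

Lemma num_cubesE (R : pzSemiRingType) A :
  (num_cubes A)%:R = \sum_y \sum_y'
    (\sum_x ((x, y) \in A)%:R * ((x, y') \in A)%:R) ^+ 2 :> R.
Proof.
have -> : (num_cubes A)%:R =
    \sum_x \sum_y \sum_u \sum_r (cube_in A (x, y) u r)%:R :> R.
  rewrite /num_cubes -sum1_card big_mkcond natr_sum /= !pair_big /=.
  by apply: eq_bigr => -[[[x y] u] r] _ /=; rewrite inE /=; case: cube_in.
rewrite exchange_big; apply: eq_bigr => y _.
under [RHS]eq_bigr do rewrite expr2 mulr_suml.
rewrite [RHS]exchange_big; apply: eq_bigr => x _.
(* The bijections [u] to [y' = y - u] and, below, [r] to [x' = x + r] turn side lengths into the
   opposite coordinates of the cube. *)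
rewrite [RHS](reindex_inj (subrI y)); apply: eq_bigr => u _.
rewrite mulr_sumr [RHS](reindex_inj (addrI x)); apply: eq_bigr => r _.
by rewrite cube_inE -!natrM !mulnb !andbA.
Qed.

Variable R : realType.

Lemma sum_row A y :
  \sum_x ((x, y) \in A)%:R = n.+1%:R * row_density R A y :> R.
Proof.
rewrite /row_density mulVKf ?pnatr_eq0// -natr_sum -sum1_card [in RHS]big_mkcond /=.
by congr (_%:R); apply: eq_bigr => x _; rewrite inE; case: (_ \in _).
Qed.

Lemma sum_row_density A :
  \sum_y row_density R A y = #|A|%:R / n.+1%:R.
Proof.
apply: (canRL (mulfK _)); first by rewrite pnatr_eq0.
rewrite mulrC mulr_sumr; under eq_bigr do rewrite -sum_row.
rewrite exchange_big pair_big /= -natr_sum -sum1_card [in RHS]big_mkcond /=.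
by congr (_%:R); apply: eq_bigr => -[x y] _ /=; case: (_ \in _).
Qed.

Lemma sum_row_mul A y y' :
  \sum_x ((x, y) \in A)%:R * ((x, y') \in A)%:R =
  \sum_x balanced R A x y * balanced R A x y' +
    n.+1%:R * (row_density R A y * row_density R A y').
Proof.
set d := row_density R A.
(* Each of the last three terms sums over [x] to [N * d y * d y'] up to sign; two plus signs and one
   minus leave a single copy. *)
transitivity (\sum_x (balanced R A x y * balanced R A x y'
  + (((x, y) \in A)%:R * d y' + d y * ((x, y') \in A)%:R - d y * d y'))).
  by apply: eq_bigr => x _; rewrite /balanced -/d; ring.
rewrite big_split sumrB big_split /= -mulr_suml -mulr_sumr !sum_row -/d.
by rewrite sumr_const card_ord -mulr_natl; ring.
Qed.

(** Variance decomposition: by the hypothesis on [#|A|], the mean of the row densities is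
    [delta]. *)
Lemma sum_row_density_sqr A (delta : R) :
    #|A|%:R = delta * n.+1%:R ^+ 2 ->
  \sum_y row_density R A y ^+ 2 =
  n.+1%:R * delta ^+ 2 + \sum_y (row_density R A y - delta) ^+ 2.
Proof.
move=> hA; have N0 : n.+1%:R != 0 :> R by rewrite pnatr_eq0.
under [in RHS]eq_bigr do rewrite sqrrB -mulrnAl.
rewrite big_split sumrB /= -mulr_suml sumrMnl sum_row_density hA.
rewrite sumr_const card_ord -(mulr_natl (delta ^+ 2)).
by move: (n.+1%:R) N0 => N N0; field.
Qed.

End CubeCount.

(* N = n.+1. The function balanced R A is real-valued, so it is its own complex
   conjugate. *)
Theorem theorem3p7 (R : realType) (n : nat) (alpha delta : R)
    (A : {set 'I_n.+1 * 'I_n.+1})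
    (halpha : 0 <= alpha <= 1)
    (hA : #|A|%:R = delta * n.+1%:R ^+ 2)
    (hunif : \sum_(y : 'I_n.+1) \sum_(y' : 'I_n.+1)
        `| \sum_(x : 'I_n.+1) balanced R A x y * balanced R A x y' | ^+ 2
      <= alpha * n.+1%:R ^+ 4)
    (hdelta : \sum_(y : 'I_n.+1) (row_density R A y - delta) ^+ 2
      <= alpha * n.+1%:R) :
  (num_cubes A)%:R <= (delta + 2 * alpha `^ 4^-1) ^+ 4 * n.+1%:R ^+ 4.
Proof.
have [a0 a1] := andP halpha.
set b := alpha `^ 4^-1; set N : R := n.+1%:R.
have N0 : 0 < N by rewrite ltr0n.
have b0 : 0 <= b by exact: powR_ge0.
(* Writing [alpha] as [b ^+ 4] makes every later bound polynomial in [b]. *)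
have bE : b ^+ 4 = alpha.
  by rewrite -powR_mulrn// /b -powRrM mulVf ?pnatr_eq0// powRr1.
have b1 : b <= 1 by rewrite -(@ler_pXn2r _ 4) ?nnegrE// bE expr1n.
have d0 : 0 <= delta.
  by rewrite -(pmulr_lge0 _ (exprn_gt0 2 N0)) -hA ler0n.
set g := fun p : 'I_n.+1 * 'I_n.+1 =>
  \sum_x balanced R A x p.1 * balanced R A x p.2.
set h := fun p : 'I_n.+1 * 'I_n.+1 =>
  N * (row_density R A p.1 * row_density R A p.2).
have gle : \sum_p g p ^+ 2 <= (b ^+ 2 * N ^+ 2) ^+ 2.
  rewrite exprMn -!exprM bE (le_trans _ hunif)// pair_big /=.
  by apply: ler_sum => p _; rewrite real_normK ?num_real.
have hle : \sum_p h p ^+ 2 <= ((delta ^+ 2 + b ^+ 4) * N ^+ 2) ^+ 2.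
  (* [h] is a product of a function of [y] and one of [y'], so its sum of squares factors. *)
  have -> : \sum_p h p ^+ 2 = (N * \sum_y row_density R A y ^+ 2) ^+ 2.
    rewrite exprMn [in RHS](expr2 (\sum_i _)) mulr_suml mulr_sumr.
    rewrite -(pair_big xpredT xpredT (fun y y' => h (y, y') ^+ 2)) /=.
    apply: eq_bigr => y _; rewrite !mulr_sumr.
    by apply: eq_bigr => y' _; rewrite /h /=; ring.
  have s0 : 0 <= \sum_y row_density R A y ^+ 2.
    by apply: sumr_ge0 => y _; exact: sqr_ge0.
  rewrite ler_sqr ?nnegrE ?mulr_ge0 ?addr_ge0 ?exprn_ge0 ?(ltW N0)//.
  rewrite expr2 mulrA [leRHS]mulrC ler_pM2l// (sum_row_density_sqr hA) bE -/N.
  by rewrite -/N in hdelta; lra.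
have -> : (num_cubes A)%:R = \sum_p (g p + h p) ^+ 2.
  rewrite num_cubesE pair_big /=.
  by apply: eq_bigr => p _; rewrite sum_row_mul.
apply: le_trans (sum_sqrD_le _ _ gle hle) _.
- by rewrite mulr_ge0 ?exprn_ge0 ?(ltW N0).
- by rewrite mulr_ge0 ?addr_ge0 ?exprn_ge0 ?(ltW N0).
have -> : (delta + 2 * b) ^+ 4 * N ^+ 4 = ((delta + 2 * b) ^+ 2 * N ^+ 2) ^+ 2.
  by ring.
rewrite -mulrDl ler_sqr ?nnegrE ?mulr_ge0 ?addr_ge0 ?exprn_ge0 ?(ltW N0) ?mulr_ge0//.
rewrite ler_pM2r ?exprn_gt0//.
(* What remains is [b^2 + delta^2 + b^4 <= delta^2 + 4 b delta + 4 b^2]; here [b <= 1], that is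
   [alpha <= 1], absorbs [b^4]. *)
have b42 : b ^+ 4 <= b ^+ 2 by exact: ler_wiXn2l.
have bd0 : 0 <= b * delta by exact: mulr_ge0.
have bb0 : 0 <= b ^+ 2 by exact: sqr_ge0.
rewrite sqrrD; lra.
Qed.
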